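(* Let $G(V,E)$ be an interaction network and let $s$ be the source vertex of $G$. Let $s v_1 v_2\cdots v_k$ be a chain in $G$ starting at the source, i.e. $s,v_1,\dots,v_k$ are distinct vertices, $(s,v_1),(v_1,v_2),\dots,(v_{k-1},v_k)\in E$, and for each $i<k$ the in-degree and the out-degree of $v_i$ in $G$ are $1$. Then $G$ can be reduced to the interaction network $G'(V',E')$ with $$V'=V\setminus\{v_1,\dots,v_{k-1}\},\qquad E'=\bigl(E\setminus\{(s,v_1),(v_1,v_2),\dots,(v_{k-1},v_k)\}\bigr)\cup\{(s,v_k)\},$$ where the interactions on the new edge $(s,v_k)$ are those that determine the total quantity buffered at $v_k$ after running the greedy algorithm on the chain $s v_1\cdots v_k$: writing $v_0=s$, for each interaction $(t_i,q_i)$ on $(v_{k-1},v_k)$ that increases the buffer $B_{v_k}$ in that run, the new edge gets the interaction $(t_i,\min\{q_i,B_{v_{k-1}}\})$, where $B_{v_{k-1}}$ is the quantity buffered at $v_{k-1}$ when this interaction is processed. (If $E\setminus\{(s,v_1),\dots,(v_{k-1},v_k)\}$ already contains an edge $(s,v_k)$, the two edges are merged into one edge carrying the interactions of both.) All other edges keep their interactions. Then the maximum flow throughout $G$ is equal to the maximum flow throughout $G'$.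
   Context: An interaction network is a finite directed graph $G(V,E)$ in which every edge $e=(v,u)\in E$ carries a finite sequence $e_S=\{(t_1,q_1),(t_2,q_2),\dots\}$ of interactions from $v$ to $u$; an interaction $(t_i,q_i)$ has a timestamp $t_i$ and a (nonnegative) quantity $q_i$. The graph $G$ is connected, and has a single source vertex $s$ (with no incoming edges) and a single sink vertex $t$ (with no outgoing edges); flow is measured from $s$ to $t$. Buffers: each vertex $v$ has a buffer $B_v$. The buffer of $s$ is always $\infty$; all other buffers are initially $0$. There is no bound on how much a vertex can buffer, and buffered quantities do not expire. All interactions of the network under consideration are processed in order of time. When an interaction on edge $(v,u)$ transfers a quantity $q$, $B_v$ is decreased by $q$ (it remains $\infty$ if $v=s$) and $B_u$ is increased by $q$. Greedy algorithm (here applied to the chain $sv_1\cdots v_k$ with the interactions on its edges): every interaction $(t_i,q_i)$ on an edge $(v,u)$ transfers the maximum possible quantity $q=\min\{q_i,B_v\}$, where $B_v$ is the quantity buffered at $v$ at that moment. Maximum flow of a network with source $s$ and sink $t$: every interaction $(t_i,q_i)$ on an edge $(v,u)$ may transfer any quantity in $[0,\min\{q_i,B_v\}]$, where $B_v$ is the quantity buffered at $v$ at that moment, the rest being reserved at $v$ for future outgoing interactions of $v$. The maximum flow is the largest value of $B_t$, after all interactions have been processed, over all such choices of transferred quantities. *)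

(* Defs.v *)
From HB Require Import structures.
From mathcomp Require Import all_boot all_order all_algebra.
From mathcomp Require Import reals constructive_ereal.

Set Implicit Arguments.
Unset Strict Implicit.
Unset Printing Implicit Defensive.

Import Order.TTheory GRing.Theory Num.Theory.
Local Open Scope ring_scope.

(* An interaction is a pair (timestamp, quantity); an event is an interaction
   together with the edge that carries it. *)
Notation interaction R := (R * R)%type.
Notation event R T := ((T * T) * interaction R)%type.

(* The vertices form a subset of an ambient finite type, so that vertices can
   be removed without changing the type.  The value of [inter] outside [edges]
   is irrelevant. *)
Record network (R : realType) (T : finType) := Network {
  verts : {set T};
  edges : {set T * T};
  inter : T * T -> seq (interaction R);
  src : T;
  snk : T }.

Section Networks.
Variables (R : realType) (T : finType).
Implicit Types (G : network R T) (p : seq (event R T)) (B : T -> \bar R).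
Implicit Types (vs : seq T) (e : T * T) (ev : event R T).

Definition adjacent G : rel T :=
  fun u v => ((u, v) \in edges G) || ((v, u) \in edges G).

Definition indeg G v := #|[set u | (u, v) \in edges G]|.
Definition outdeg G v := #|[set u | (v, u) \in edges G]|.

Record interaction_network G : Prop := InteractionNetwork {
  edges_verts : forall e, e \in edges G -> e.1 \in verts G /\ e.2 \in verts G;
  inter_ge0 : forall e i, e \in edges G -> i \in inter G e -> 0 <= i.2;
  src_verts : src G \in verts G;
  snk_verts : snk G \in verts G;
  single_src : forall v, v \in verts G -> (indeg G v = 0%N <-> v = src G);
  single_snk : forall v, v \in verts G -> (outdeg G v = 0%N <-> v = snk G);
  connected : forall u v, u \in verts G -> v \in verts G ->
    connect (adjacent G) u v }.

(* [p] lists all interactions of G in order of time.  It is determined by G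
   when the timestamps are pairwise distinct; otherwise it also records how
   simultaneous interactions are ordered. *)
Definition processing_order G p : Prop :=
  perm_eq p [seq (e, i) | e <- enum (edges G), i <- inter G e] /\
  sorted (fun ev1 ev2 => ev1.2.1 <= ev2.2.1) p.

Definition init_buffer G : T -> \bar R :=
  fun v => if v == src G then +oo%E else 0%E.

(* A buffer equal to +oo is unchanged, because +oo - x%:E = +oo. *)
Definition transfer B e (x : R) : T -> \bar R := fun w =>
  (B w - (if w == e.1 then x%:E else 0) + (if w == e.2 then x%:E else 0))%E.

(* [run B p B'] : processing p from buffers B may end with buffers B'. *)
Inductive run : (T -> \bar R) -> seq (event R T) -> (T -> \bar R) -> Prop :=
| run_nil B : run B [::] B
| run_cons B ev p (x : R) B' :
    0 <= x -> (x%:E <= Order.min ev.2.2%:E (B ev.1.1))%E ->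
    run (transfer B ev.1 x) p B' ->
    run B (ev :: p) B'.

Definition achievable_flow G p (m : \bar R) : Prop :=
  exists2 B, run (init_buffer G) p B & B (snk G) = m.

Definition is_max_flow G p (m : \bar R) : Prop :=
  achievable_flow G p m /\
  forall m', achievable_flow G p m' -> (m' <= m)%E.

(* The minimum is finite, since a quantity is finite and buffers are
   nonnegative. *)
Definition greedy_amount B ev : R :=
  fine (Order.min ev.2.2%:E (B ev.1.1)).

Definition greedy_step B ev : T -> \bar R :=
  transfer B ev.1 (greedy_amount B ev).

(* For vs = [:: v_1; ...; v_k] :
   chain_end   = v_k
   inner       = [:: v_1; ...; v_(k-1)]
   chain_edges = [:: (s, v_1); (v_1, v_2); ...; (v_(k-1), v_k)]
   last_edge   = (v_(k-1), v_k), with v_0 = s *)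
Definition chain_end G vs : T := last (src G) vs.
Definition inner G vs : seq T := behead (belast (src G) vs).
Definition chain_edges G vs : seq (T * T) := zip (belast (src G) vs) vs.
Definition last_edge G vs : T * T :=
  (last (src G) (inner G vs), chain_end G vs).

Definition source_chain G vs : Prop :=
  [/\ vs <> [::], uniq (src G :: vs),
      path (fun u v => (u, v) \in edges G) (src G) vs &
      forall v, v \in inner G vs -> indeg G v = 1%N /\ outdeg G v = 1%N].

(* Runs the greedy algorithm on the events of p that lie on the chain, the
   others having no effect on B.  The events of the chain are replaced by
   those of the new edge (s, v_k); the events off the chain stay in place. *)
Fixpoint reduce_events G vs B p : seq (event R T) :=
  if p is ev :: p' then
    if ev.1 \in chain_edges G vs then
      let B' := greedy_step B ev in
      let rest := reduce_events G vs B' p' in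
      let vk := chain_end G vs in
      if (ev.1 == last_edge G vs) && (B vk < B' vk)%E
      then ((src G, vk), (ev.2.1, greedy_amount B ev)) :: rest
      else rest
    else ev :: reduce_events G vs B p'
  else [::].

Definition reduced_order G vs p : seq (event R T) :=
  reduce_events G vs (init_buffer G) p.

Definition new_interactions G vs p : seq (interaction R) :=
  [seq ev.2 | ev <- reduced_order G vs
                      [seq ev <- p | ev.1 \in chain_edges G vs]].

Definition kept_edges G vs : {set T * T} :=
  edges G :\: [set e in chain_edges G vs].

Definition reduced_network G vs p : network R T := {|
  verts := verts G :\: [set v in inner G vs];
  edges := (src G, chain_end G vs) |: kept_edges G vs;
  inter := fun e =>
    (if e \in kept_edges G vs then inter G e else [::]) ++
    (if e == (src G, chain_end G vs) then new_interactions G vs p else [::]);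
  src := src G;
  snk := snk G |}.

End Networks.

(* Main.v *)
(* Processing the events in order, the i-th vertex of the chain never receives
   more in total than it does in the greedy run. So any run of G can be
   imitated in G', where the new edge delivers the greedy amounts: v_k is ahead
   of the run of G at every moment, and the other vertices agree. Conversely, a
   run of G' lifts to G by running the chain greedily and holding back at
   v_(k-1) what the new edge does not use. A maximum is attained in G' because
   the best final value after each event is a Lipschitz function of the
   buffers. *)

Require Import Defs.
From HB Require Import structures.
From mathcomp Require Import all_boot all_order all_algebra.
From mathcomp Require Import boolp classical_sets reals constructive_ereal.
From mathcomp Require Import topology normedtype derive.
From mathcomp Require Import lra zify.

Set Implicit Arguments.
Unset Strict Implicit.
Unset Printing Implicit Defensive.

Import Order.TTheory GRing.Theory Num.Theory.
Import numFieldNormedType.Exports.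
Local Open Scope ring_scope.

(** * Runs with real-valued buffers *)

Section RealBuffers.
Variables (R : realType) (T : finType) (s : T).
Implicit Types (b c : T -> R) (p : seq (event R T)) (ev : event R T).

(* The entry of b at s is a junk value on which no capacity depends. *)
Definition ebuffer b : T -> \bar R := fun v => if v == s then +oo%E else (b v)%:E.

Definition rtransfer b (e : T * T) (x : R) : T -> R := fun w =>
  b w - (if w == e.1 then x else 0) + (if w == e.2 then x else 0).

Definition capacity b ev : R :=
  if ev.1.1 == s then ev.2.2 else Num.min ev.2.2 (b ev.1.1).

(** A recursive counterpart of [run]: it unfolds at each event, so that inductions on the event list
    need no inversion. *)
Fixpoint reach b p b' : Prop :=
  if p is ev :: p' then
    exists x : R, [/\ 0 <= x, x <= capacity b ev & reach (rtransfer b ev.1 x) p' b']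
  else b' = b.

Lemma transfer_ebuffer b e x :
  transfer (ebuffer b) e x = ebuffer (rtransfer b e x).
Proof.
apply/funext => w; rewrite /transfer /ebuffer /rtransfer.
by case: (w == s) => //; do 2 case: ifP => _ //.
Qed.

Lemma min_ebuffer b ev :
  Order.min ev.2.2%:E (ebuffer b ev.1.1) = (capacity b ev)%:E.
Proof.
rewrite /ebuffer /capacity; case: ifP => _; last by rewrite EFin_min.
by rewrite min_l // leey.
Qed.

(** The source buffer stays [+oo] under every transfer and all other entries stay finite, so the
    extended reals can be left behind. *)
Lemma runP b p B' :
  run (ebuffer b) p B' <-> exists2 b', B' = ebuffer b' & reach b p b'.
Proof.
elim: p b B' => [|ev p IHp] b B' /=; split.
- by move=> H; inversion H; subst; exists b.
- by case=> b' -> ->; constructor.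
- move=> H; inversion H; subst.
  move: H6; rewrite transfer_ebuffer => /IHp[b' -> hb'].
  exists b' => //; exists x; split => //.
  by rewrite -lee_fin -min_ebuffer.
- case=> b' -> [x [x0 xc hb']].
  apply: (@run_cons _ _ _ _ _ x) => //; first by rewrite min_ebuffer lee_fin.
  by rewrite transfer_ebuffer; apply/IHp; exists b'.
Qed.

Lemma greedy_amountE b ev : greedy_amount (ebuffer b) ev = capacity b ev.
Proof. by rewrite /greedy_amount min_ebuffer. Qed.

Lemma greedy_stepE b ev :
  greedy_step (ebuffer b) ev = ebuffer (rtransfer b ev.1 (capacity b ev)).
Proof. by rewrite /greedy_step greedy_amountE transfer_ebuffer. Qed.

Definition nonneg_buffer b := forall v, v != s -> 0 <= b v.

Lemma capacity_ge0 b ev : nonneg_buffer b -> 0 <= ev.2.2 -> 0 <= capacity b ev.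
Proof.
by rewrite /capacity => b0 q0; case: eqVneq => // /b0 b1; rewrite le_min q0.
Qed.

Lemma nonneg_rtransfer b ev x : nonneg_buffer b -> 0 <= x <= capacity b ev ->
  nonneg_buffer (rtransfer b ev.1 x).
Proof.
move=> b0 /andP[x0 xc] v vs; rewrite /rtransfer.
have := b0 _ vs; move: xc; rewrite /capacity.
case: (eqVneq v ev.1.1) => [<-|_]; rewrite ?(negPf vs) ?le_min.
  by case/andP=> _; case: ifP => _; lra.
by move=> _; case: ifP => _; lra.
Qed.

(** * Lipschitz dependence on the buffers and existence of a maximum *)

Definition dist b c : R := \sum_v `|b v - c v|.

Lemma dist_ge b c v : `|b v - c v| <= dist b c.
Proof. by rewrite /dist (bigD1 v) //= lerDl sumr_ge0. Qed.

(** Only the entries at the tail and the head of [e] are affected, each by at most [|x - y|]; on a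
    loop the two changes cancel. *)
Lemma dist_rtransfer b c e x y :
  dist (rtransfer b e x) (rtransfer c e y) <= dist b c + `|x - y| + `|x - y|.
Proof.
have sum1 (u : T) : \sum_v (if v == u then `|x - y| else 0) = `|x - y|.
  by rewrite -big_mkcond big_pred1_eq.
rewrite -{2}(sum1 e.2) -{1}(sum1 e.1) /dist -!big_split /=.
apply: ler_sum => v _; rewrite /rtransfer.
case: (v == e.1); case: (v == e.2); rewrite ?subr0 ?addr0.
- rewrite (_ : b v - x + x - (c v - y + y) = b v - c v); last by lra.
  by rewrite -addrA lerDl addr_ge0.
- rewrite (_ : b v - x - (c v - y) = (b v - c v) - (x - y)); last by lra.
  exact: ler_normB.
- rewrite (_ : b v + x - (c v + y) = (b v - c v) + (x - y)); last by lra.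
  exact: ler_normD.
- by [].
Qed.

Lemma capacity_lipschitz b c ev :
  `|capacity b ev - capacity c ev| <= `|b ev.1.1 - c ev.1.1|.
Proof.
rewrite /capacity; case: ifP => _; first by rewrite subrr normr0.
move: (ev.2.2) (b _) (c _) => q x y.
by case: (leP q x) => ?; case: (leP q y) => ?;
  rewrite ler_norml; case: (ger0P (x - y)); lra.
Qed.

Variable t : T.

Definition max_reach b p (m : R) : Prop :=
  (exists2 b', reach b p b' & b' t = m) /\
  forall b', reach b p b' -> b' t <= m.

(* Lipschitz continuity of the maximum in the initial buffers is what makes
   the induction work: the first transfer is then chosen by maximizing a
   continuous function on a segment. *)
Lemma max_reach_exists p : (forall ev, ev \in p -> 0 <= ev.2.2) ->
  exists K : R, [/\ 0 <= K,
    (forall b, nonneg_buffer b -> exists m, max_reach b p m) &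
    (forall b c m m', nonneg_buffer b -> nonneg_buffer c ->
       max_reach b p m -> max_reach c p m' -> m <= m' + K * dist b c)].
Proof.
elim: p => [|ev p IHp] q0.
  exists 1; split => // [b b0|b c m m' b0 c0 [[b' -> <-] _] [[c' -> <-] _]].
    by exists (b t); split; [exists b|move=> b' ->].
  have := dist_ge b c t; have := ler_norm (b t - c t); lra.
have q0p : forall ev, ev \in p -> 0 <= ev.2.2.
  by move=> e ep; apply: q0; rewrite inE ep orbT.
have qev : 0 <= ev.2.2 by apply: q0; rewrite inE eqxx.
have [K [K0 ex lip]] := IHp q0p.
have tr0 b x : nonneg_buffer b -> 0 <= x <= capacity b ev ->
    nonneg_buffer (rtransfer b ev.1 x) by exact: nonneg_rtransfer.
(* From buffers at distance [d], first transfers can be matched up to [d]; each changes two entries,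
   which leaves buffers at distance at most [3 d]. *)
exists (K * 3); split; first by rewrite mulr_ge0.
- move=> b b0; set c := capacity b ev.
  have c0 : 0 <= c by exact: capacity_ge0.
  (* Clamping extends the choice of the first amount from [[0, c]] to all reals, so that the optimum
     [f] of the remaining events is a total Lipschitz function. *)
  pose clamp x : R := Num.max 0 (Num.min c x).
  have clampP x : 0 <= clamp x <= c.
    by rewrite /clamp le_max lexx ge_max c0 ge_min lexx.
  have clamp_lip x y : `|clamp x - clamp y| <= `|x - y|.
    rewrite /clamp; case: (leP c x) => ?; case: (leP c y) => ?;
      rewrite ?(max_r c0); try case: (leP 0 x) => ?; try case: (leP 0 y) => ?;
      by rewrite ler_norml; case: (ger0P (x - y)); lra.
  have [f fP] : {f : R -> R &
      forall x, max_reach (rtransfer b ev.1 (clamp x)) p (f x)}.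
    by have [f ?] := choice (fun x => ex _ (tr0 _ _ b0 (clampP x))); exists f.
  have f_lip x y : `|f x - f y| <= K * 2 * `|x - y|.
    have fle x' y' : f x' <= f y' + K * 2 * `|x' - y'|.
      apply: (le_trans (lip _ _ _ _ (tr0 _ _ b0 (clampP x')) (tr0 _ _ b0 (clampP y'))
                 (fP x') (fP y'))).
      rewrite lerD2l -mulrA ler_wpM2l //.
      apply: (le_trans (dist_rtransfer _ _ _ _ _)).
      rewrite [dist b b]big1; last by move=> v _; rewrite subrr normr0.
      by have := clamp_lip x' y'; lra.
    by rewrite ler_norml; have := fle x y; have := fle y x; rewrite (distrC y x); lra.
  have [x /andP[x0 xc] xmax] : exists2 x, 0 <= x <= c &
      forall y, 0 <= y <= c -> f y <= f x.
    have cf : {within `[0, c], continuous f}%classic.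
      apply: continuous_subspaceT => x; apply/cvgrPdist_le => e e0.
      (* The added 1 keeps the divisor positive when [K] is 0. *)
      have K1 : 0 < K * 2 + 1 by lra.
      near=> y; apply: (le_trans (f_lip _ _)).
      apply: (@le_trans _ _ ((K * 2 + 1) * `|x - y|)).
        by have := normr_ge0 (x - y); lra.
      rewrite mulrC -ler_pdivlMr //.
      near: y; apply: cvgr_dist_le => //; exact: divr_gt0.
    have [x xc xmax] := EVT_max c0 cf.
    by exists x; [move: xc; rewrite in_itv|move=> y yc; apply: xmax; rewrite in_itv].
  have clampE y : 0 <= y <= c -> clamp y = y.
    by case/andP=> y0 yc; rewrite /clamp min_r // max_r.
  exists (f x); split.
    have [[b' hb' <-] _] := fP x; exists b' => //=; exists x; split=> //.
    by rewrite -[x]clampE // x0.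
  move=> b' /= [y [y0 yc hb']]; apply: (le_trans _ (xmax y _)); last by rewrite y0.
  by have [_] := fP y; apply; rewrite clampE // y0.
- move=> b c m m' b0 c0 [[b' /= [x [x0 xc hb']] <-] mmax] [_ m'max].
  (* The run from [c] imitates the transfer [x] as far as its own capacity allows; the shortfall is
     at most the gap between the capacities, hence at most [dist b c]. *)
  pose y := Num.min x (capacity c ev).
  have y0c : 0 <= y <= capacity c ev.
    by rewrite /y le_min x0 capacity_ge0 //= ge_min lexx orbT.
  have xy : `|x - y| <= dist b c.
    apply: (le_trans _ (dist_ge b c ev.1.1)).
    apply: (le_trans _ (capacity_lipschitz b c ev)).
    rewrite /y; case: (leP x (capacity c ev)) => h; first by rewrite subrr normr0.
    apply: (@le_trans _ _ (capacity b ev - capacity c ev)); last exact: ler_norm.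
    by rewrite ger0_norm; lra.
  have x0c : 0 <= x <= capacity b ev by rewrite x0.
  have [m1 hm1] := ex _ (tr0 _ _ b0 x0c); have [m2 hm2] := ex _ (tr0 _ _ c0 y0c).
  apply: (le_trans (hm1.2 _ hb')); apply: (le_trans (lip _ _ _ _ _ _ hm1 hm2)).
  - exact: tr0.
  - exact: tr0.
  apply: lerD.
    have [[c' hc' <-] _] := hm2; apply: m'max => /=; exists y.
    by case/andP: y0c.
  rewrite -mulrA ler_wpM2l //; apply: (le_trans (dist_rtransfer _ _ _ _ _)).
  by move: xy; lra.
Unshelve. all: by end_near.
Qed.

End RealBuffers.

(** * Combinatorics of the source chain *)

Section Chain.
Variables (R : realType) (T : finType) (G : network R T) (vs : seq T).
Hypothesis netG : interaction_network G.
Hypothesis chainG : source_chain G vs.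

Local Notation s := (src G).
Local Notation vk := (chain_end G vs).
Local Notation k := (size vs).
Local Notation chain := (chain_edges G vs).
Local Notation node := (nth s (s :: vs)).

Lemma size_chain_gt0 : (0 < k)%N.
Proof. by case: chainG; case: vs. Qed.

Lemma nth_belast_source i : (i < k)%N -> nth s (belast s vs) i = node i.
Proof. by move=> ik; rewrite lastI nth_rcons size_belast ik. Qed.

Lemma chain_endE : vk = node k.
Proof. by rewrite /chain_end -nth_last /=; case: vs size_chain_gt0. Qed.

(** With the source at index 0 and [v_i] at index [i], distinctness of chain vertices becomes
    arithmetic on indices. *)
Lemma chain_edgesP e :
  reflect (exists2 j, (j < k)%N & e = (node j, node j.+1)) (e \in chain).
Proof.
have sz : size chain = k by rewrite size_zip size_belast minnn.
apply: (iffP (nthP (s, s))); rewrite sz => -[j jk je]; exists j => //.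
  by rewrite -je nth_zip ?size_belast // nth_belast_source.
by rewrite je nth_zip ?size_belast // nth_belast_source.
Qed.

Lemma chain_edge_nodes u v : (u, v) \in chain ->
  exists j, [/\ (j < k)%N, u = node j & v = node j.+1].
Proof. by case/chain_edgesP=> j jk [uE vE]; exists j. Qed.

Lemma innerE : s :: inner G vs = belast s vs.
Proof. by rewrite /inner; case: vs size_chain_gt0. Qed.

Lemma innerP v :
  reflect (exists i, [/\ (0 < i)%N, (i < k)%N & v = node i]) (v \in inner G vs).
Proof.
have sz : (size (inner G vs)).+1 = k by rewrite -(size_belast s vs) -innerE.
have nthE i : (i.+1 < k)%N -> nth s (inner G vs) i = node i.+1.
  by move=> ik; rewrite -nth_belast_source // -innerE.
apply: (iffP (nthP s)) => [[i ik <-]|[[|i] [// _ ik ->]]].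
  by exists i.+1; split=> //; [rewrite -sz|rewrite nthE // -sz].
by exists i; [rewrite -ltnS sz|rewrite nthE].
Qed.

Lemma node_inner i : (0 < i)%N -> (i < k)%N -> node i \in inner G vs.
Proof. by move=> i0 ik; apply/innerP; exists i. Qed.

Lemma eq_node i j : (i <= k)%N -> (j <= k)%N -> (node i == node j) = (i == j).
Proof. by case: chainG => _ us _ _ ik jk; rewrite nth_uniq. Qed.

Lemma last_edgeE : last_edge G vs = (node k.-1, node k).
Proof.
rewrite /last_edge -chain_endE -[last s _]/(last s (s :: inner G vs)) innerE.
rewrite -nth_last size_belast nth_belast_source //.
by have := size_chain_gt0; case: k.
Qed.

Lemma eq_last_edge j : (j < k)%N ->
  ((node j, node j.+1) == last_edge G vs) = (j.+1 == k).
Proof.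
move=> jk; rewrite last_edgeE xpair_eqE !eq_node ?leq_pred //; last exact: ltnW.
by have := size_chain_gt0; move: jk; case: k => // n _ _; rewrite eqSS andbb.
Qed.

Lemma chain_end_neq_src : vk != s.
Proof.
rewrite chain_endE -[X in _ != X]/(node 0) eq_node //.
by have := size_chain_gt0; lia.
Qed.

Lemma chain_end_notin_inner : vk \notin inner G vs.
Proof.
apply/negP => /innerP[i [_ ik /eqP]]; rewrite chain_endE eq_node ?(ltnW ik) //; lia.
Qed.

Lemma src_notin_inner : s \notin inner G vs.
Proof.
apply/negP => /innerP[i [i0 ik /eqP]].
by rewrite -[X in X == _]/(node 0) eq_node ?(ltnW ik) //; lia.
Qed.

Lemma chain_edge_edge j : (j < k)%N -> (node j, node j.+1) \in edges G.
Proof. by case: chainG => _ _ /(pathP s) + _ => /[apply]. Qed.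

(** Out-degree 1 leaves the edge of the chain as the only way out. *)
Lemma edge_from_inner e : e \in edges G -> e.1 \in inner G vs -> e \in chain.
Proof.
case: e => u w /= ew ui; have := ui; case: chainG => _ _ _ /(_ _ ui)[_ d1].
move=> /innerP[j [j0 jk uE]]; apply/chain_edgesP; exists j => //.
move: d1 => /eqP /cards1P[y yE].
have : w \in [set x | (u, x) \in edges G] by rewrite inE.
have := chain_edge_edge jk; rewrite -uE => h.
have : node j.+1 \in [set x | (u, x) \in edges G] by rewrite inE.
by rewrite yE !inE => /eqP -> /eqP ->.
Qed.

Lemma edge_to_inner e : e \in edges G -> e.2 \in inner G vs -> e \in chain.
Proof.
case: e => w u /= ew ui; have := ui; case: chainG => _ _ _ /(_ _ ui)[d1 _].
move=> /innerP[[|j] [// _ jk uE]]; apply/chain_edgesP; exists j; first exact: ltnW.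
move: d1 => /eqP /cards1P[y yE].
have : w \in [set x | (x, u) \in edges G] by rewrite inE.
have := chain_edge_edge (ltnW jk); rewrite -uE => h.
have : node j \in [set x | (x, u) \in edges G] by rewrite inE.
by rewrite yE !inE => /eqP -> /eqP ->.
Qed.

(** Consequently events off the chain neither read nor change an inner buffer, and both simulations
    below can copy them. *)
Lemma kept_edge_ends e : e \in edges G -> e \notin chain ->
  e.1 \notin inner G vs /\ e.2 \notin inner G vs.
Proof.
by move=> eG ec; split; apply: contra ec; [apply: edge_from_inner|apply: edge_to_inner].
Qed.

Lemma chain_edge_tail j : (j < k)%N -> node j = s \/ node j \in inner G vs.
Proof. by case: j => [|j] jk; [left|right; apply: node_inner]. Qed.

(** * Simulations between runs of the network and runs of the reduced event list *)

Local Notation ebuf := (ebuffer s).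
Local Notation cap := (capacity s).

(** On the last edge, [v_k] is neither the source nor the tail, so its buffer increases exactly when
    the greedy amount is positive. *)
Lemma reduce_events_cons c ev p :
  reduce_events G vs (ebuf c) (ev :: p) =
    let rest := reduce_events G vs (ebuf (rtransfer c ev.1 (cap c ev))) p in
    if ev.1 \in chain then
      if (ev.1 == last_edge G vs) && (0 < cap c ev)
      then ((s, vk), (ev.2.1, cap c ev)) :: rest
      else rest
    else ev :: reduce_events G vs (ebuf c) p.
Proof.
rewrite /= greedy_stepE greedy_amountE; case: ifP => // _.
case: eqP => //= eL; rewrite /ebuffer (negPf chain_end_neq_src) lte_fin.
rewrite /rtransfer eL last_edgeE /= chain_endE eq_node ?leq_pred // eqxx.
rewrite (_ : (k == k.-1) = false); last by have := size_chain_gt0; lia.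
by rewrite subr0 ltrDl.
Qed.

Definition good_events (p : seq (event R T)) :=
  forall ev, ev \in p -> ev.1 \in edges G /\ 0 <= ev.2.2.

Lemma good_events_cons ev p : good_events (ev :: p) ->
  [/\ ev.1 \in edges G, 0 <= ev.2.2 & good_events p].
Proof.
move=> gp; have [eG q0] := gp ev (mem_head _ _); split=> // ev' ep.
by apply: gp; rewrite inE ep orbT.
Qed.

Lemma rtransferE (b : T -> R) u v x w :
  rtransfer b (u, v) x w = b w - (if w == u then x else 0) + (if w == v then x else 0).
Proof. by []. Qed.

Lemma rtransfer_id (b : T -> R) e x w : w != e.1 -> w != e.2 -> rtransfer b e x w = b w.
Proof. by rewrite /rtransfer => /negPf-> /negPf->; rewrite subr0 addr0. Qed.

Lemma notin_neq (A : seq T) u w : u \notin A -> w \in A -> w != u.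
Proof. by move=> uA wA; apply: contraNneq uA => <-. Qed.

Lemma le_capacity (b c : T -> R) ev :
  (ev.1.1 != s -> b ev.1.1 <= c ev.1.1) -> cap b ev <= cap c ev.
Proof.
rewrite /capacity; case: eqP => // _ /(_ isT) bc.
by rewrite le_min ge_min lexx /= ge_min bc orbT.
Qed.

(** Here [b], [b'] and [c] are the buffers of the lifted run, the reduced run and the greedy run.
    The lifted run moves the greedy amount on every chain edge but the last, where it moves what the
    new edge moves. Inner buffers thus dominate the greedy ones, so these amounts are always
    available. *)
Lemma reach_reduced_reach p (b b' c bf' : T -> R) :
  good_events p -> nonneg_buffer s c ->
  (forall v, v != s -> v \notin inner G vs -> b v = b' v) ->
  (forall v, v \in inner G vs -> c v <= b v) ->
  reach s b' (reduce_events G vs (ebuf c) p) bf' ->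
  exists2 bf, reach s b p bf &
    forall v, v != s -> v \notin inner G vs -> bf v = bf' v.
Proof.
elim: p b b' c => [|ev p IHp] b b' c gp c0 bb' cb; first by move=> /= ->; exists b.
have [eG q0 {}gp] := good_events_cons gp.
rewrite reduce_events_cons /=; case: ifPn => [ec|enc]; last first.
  have [e1 e2] := kept_edge_ends eG enc.
  case=> x [x0 xc hb'].
  case: (IHp (rtransfer b ev.1 x) _ _ gp c0 _ _ hb'); last first.
  - move=> bf hbf bfE; exists bf => //; exists x; split=> //.
    by apply: (le_trans xc); apply: le_capacity => e1s; rewrite bb'.
  - move=> v vi; rewrite rtransfer_id ?cb //; exact: notin_neq vi.
  - by move=> v vs' vi; rewrite /rtransfer bb'.
have [j jk eE] := chain_edgesP _ ec.
have g0 : 0 <= cap c ev := capacity_ge0 c0 q0.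
have gb : cap c ev <= cap b ev.
  apply: le_capacity; rewrite eE /= => /eqP.
  by case: (chain_edge_tail jk) => // ji _; exact: cb.
have c0' : nonneg_buffer s (rtransfer c ev.1 (cap c ev)).
  by apply: nonneg_rtransfer => //; rewrite g0 /=.
have e1n v : v != s -> v \notin inner G vs -> v != ev.1.1.
  by move=> vs' vi; rewrite eE; case: (chain_edge_tail jk) => [->|/(notin_neq vi)] //;
    rewrite eq_sym.
(* Before the last edge both runs move the same amount; on the last edge the lifted run removes
   less, and the head [v_k] is not inner. *)
have step x y : x <= y -> (ev.1 != last_edge G vs -> y <= x) ->
    forall v, v \in inner G vs ->
    rtransfer c ev.1 y v <= rtransfer b ev.1 x v.
  move=> xy nlast v vi; rewrite /rtransfer; have := cb _ vi.
  case: (eqVneq ev.1 (last_edge G vs)) nlast => [->|_ /(_ isT) yx].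
    have /negPf-> : v != (last_edge G vs).2.
      exact: notin_neq chain_end_notin_inner vi.
    by case: ifP => _; lra.
  by do 2 case: ifP => _; lra.
case: ifPn => [/andP[/eqP eL gpos]|nL].
  case=> x [x0 xg hb'].
  have {}xg : x <= cap c ev by move: xg; rewrite {1}/capacity /= eqxx.
  case: (IHp (rtransfer b ev.1 x) _ _ gp c0' _ _ hb'); last first.
  - move=> bf hbf bfE; exists bf => //; exists x; split=> //; exact: le_trans gb.
  - by apply: step => //; rewrite eL eqxx.
  - move=> v vs' vi; rewrite /rtransfer /= (negPf vs') (negPf (e1n _ vs' vi)) bb' //.
    by rewrite eL.
move=> hb'; case: (IHp (rtransfer b ev.1 (cap c ev)) _ _ gp c0' _ _ hb'); last first.
- by move=> bf hbf bfE; exists bf => //; exists (cap c ev); split.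
- exact: step.
(* Without a new interaction, either the greedy amount is zero or the head is inner, so no buffer
   surviving in the reduced network gains anything. *)
- move=> v vs' vi; rewrite -bb' // /rtransfer (negPf (e1n _ vs' vi)) subr0.
  case: (eqVneq v ev.1.2) => [ve|_]; last by rewrite addr0.
  suff -> : cap c ev = 0 by rewrite addr0.
  move: nL; rewrite negb_and -leNgt => /orP[|g0']; last by apply/eqP; rewrite eq_le g0'.
  rewrite eE eq_last_edge // => jk'; move: vi; rewrite ve eE node_inner //=; lia.
Qed.

(* A i and Ag i are the quantities received so far by the i-th vertex of the
   chain in the given run and in the greedy run: greedy receipts dominate. *)
Lemma reach_reach_reduced p (b b' c bf : T -> R) (A Ag : nat -> R) :
  good_events p -> nonneg_buffer s c ->
  (forall v, v != s -> v \notin inner G vs ->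
     b' v = b v + (if v == vk then Ag k - A k else 0)) ->
  (forall i, (0 < i)%N -> (i < k)%N -> b (node i) = A i - A i.+1) ->
  (forall i, (0 < i)%N -> (i < k)%N -> c (node i) = Ag i - Ag i.+1) ->
  (forall i, (0 < i)%N -> (i <= k)%N -> A i <= Ag i) ->
  reach s b p bf ->
  exists2 bf', reach s b' (reduce_events G vs (ebuf c) p) bf' &
    forall v, v != s -> v \notin inner G vs -> bf v <= bf' v.
Proof.
elim: p b b' c A Ag => [|ev p IHp] b b' c A Ag gp c0 b'E bA cA AAg.
  move=> /= ->; exists b' => // v vs' vi; rewrite b'E // lerDl.
  by case: ifP => // _; rewrite subr_ge0 AAg // size_chain_gt0.
have bb' v : v != s -> v \notin inner G vs -> b v <= b' v.
  move=> vs' vi; rewrite b'E // lerDl.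
  by case: ifP => // _; rewrite subr_ge0 AAg // size_chain_gt0.
have [eG q0 {}gp] := good_events_cons gp.
case=> x [x0 xc hb]; rewrite reduce_events_cons /=; case: ifPn => [ec|enc]; last first.
  have [e1 e2] := kept_edge_ends eG enc.
  case: (IHp _ (rtransfer b' ev.1 x) c A Ag gp c0 _ _ _ _ hb) => //.
  - by move=> v vs' vi; rewrite /rtransfer b'E //; case: ifP => _; lra.
  - move=> i i0 ik; rewrite rtransfer_id ?bA //;
      exact: notin_neq (node_inner i0 ik).
  - move=> bf' hbf' bfE; exists bf' => //; exists x; split=> //.
    by apply: (le_trans xc); apply: le_capacity => e1s; exact: bb'.
have [j jk eE] := chain_edgesP _ ec.
have g0 : 0 <= cap c ev := capacity_ge0 c0 q0.
have c0' : nonneg_buffer s (rtransfer c ev.1 (cap c ev)).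
  by apply: nonneg_rtransfer => //; rewrite g0 /=.
(* Only the vertex of index [j.+1] receives; what vertex [j] sends is recorded as a receipt of its
   successor. *)
pose upd (F : nat -> R) y i := F i + (if i == j.+1 then y else 0).
have updP (d : T -> R) F y :
    (forall i, (0 < i)%N -> (i < k)%N -> d (node i) = F i - F i.+1) ->
    forall i, (0 < i)%N -> (i < k)%N ->
      rtransfer d ev.1 y (node i) = upd F y i - upd F y i.+1.
  move=> dF i i0 ik; rewrite eE rtransferE dF // /upd.
  rewrite !eq_node ?eqSS ?(ltnW ik) ?(ltnW jk) //.
  by do 2 case: ifP => _; lra.
(* For [j > 0] the new receipt is at most [min (A j.+1 + q) (A j)], which is monotone in the earlier
   receipts, and greedy attains this bound with [Ag]. For [j = 0] only the quantity [q] limits the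
   transfer. *)
have updle i : (0 < i)%N -> (i <= k)%N -> upd A x i <= upd Ag (cap c ev) i.
  move=> i0 ik; rewrite /upd; have := AAg _ i0 ik.
  case: eqP => [iE|_]; last by rewrite !addr0.
  move: xc; rewrite /capacity eE /=.
  have -> : (node j == s) = (j == 0)%N.
    by rewrite -[s in _ == s]/(node 0) eq_node // ltnW.
  case: posnP => [_|jpos]; first by lra.
  rewrite bA // cA // le_min iE => /andP[xq xA].
  have := AAg _ jpos (ltnW jk); case: (leP ev.2.2 (Ag j - Ag j.+1)); lra.
have e1n v : v != s -> v \notin inner G vs -> v != ev.1.1.
  by move=> vs' vi; rewrite eE; case: (chain_edge_tail jk) => [->|/(notin_neq vi)] //;
    rewrite eq_sym.
have e2E v : v != s -> v \notin inner G vs ->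
    (v == ev.1.2) = (v == vk) && (ev.1 == last_edge G vs).
  have -> : ev.1.2 = node j.+1 by rewrite eE.
  move=> vs' vi; rewrite eE eq_last_edge // chain_endE.
  case: (eqVneq j.+1 k) => [->|jk']; first by rewrite andbT.
  rewrite andbF; apply: contraNF vi => /eqP->; rewrite node_inner //; lia.
have kE : (k == j.+1) = (ev.1 == last_edge G vs) by rewrite eE eq_last_edge // eq_sym.
(* The new edge delivers the whole greedy amount, so the surplus [Ag k - A k] at [v_k] changes by
   that amount minus [x]. *)
case: ifPn => [/andP[/eqP eL gpos]|nL].
  case: (IHp _ (rtransfer b' (s, vk) (cap c ev)) _ _ _ gp c0' _
           (updP _ _ _ bA) (updP _ _ _ cA) updle hb).
    move=> v vs' vi; rewrite /rtransfer /= (negPf vs') (negPf (e1n _ vs' vi)) e2E //.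
    by rewrite b'E // /upd kE eL eqxx andbT; case: ifP => _; lra.
  move=> bf' hbf' bfE; exists bf' => //; exists (cap c ev); split=> //.
  by rewrite {2}/capacity /= eqxx.
case: (IHp _ b' _ _ _ gp c0' _ (updP _ _ _ bA) (updP _ _ _ cA) updle hb); last first.
  by move=> bf' hbf' bfE; exists bf'.
move=> v vs' vi; rewrite /rtransfer /= (negPf (e1n _ vs' vi)) e2E // b'E // /upd kE.
case: eqP nL => //= eL; last by rewrite andbF; case: ifP; lra.
(* Greedy moves nothing over the last edge although [x] may be positive: the surplus drops by [x]
   and [b'] stays as it is. *)
rewrite -leNgt => g0'; have -> : cap c ev = 0 by apply/eqP; rewrite eq_le g0'.
by rewrite andbT; case: ifP; lra.
Qed.

End Chain.

(** * Event lists of a network and existence of a maximum flow *)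

Section Events.
Variables (R : realType) (T : finType).
Implicit Types (G : network R T) (p : seq (event R T)) (ev : event R T).

(** Edges are enumerated without repetition, so only the list of the event's own edge contributes.
    Permutations of event lists are checked through these multiplicities. *)
Lemma count_mem_events (E : {set T * T}) (f : T * T -> seq (interaction R)) ev :
  count_mem ev [seq (e, i) | e <- enum E, i <- f e] =
    if ev.1 \in E then count_mem ev.2 (f ev.1) else 0%N.
Proof.
rewrite -(mem_enum E); move: (enum E) (enum_uniq (mem E)) => es.
elim: es => //= e es IHes /andP[ees /IHes{}IHes].
rewrite count_cat IHes count_map inE; case: (eqVneq ev.1 e) => [eE|ne] /=.
  rewrite -eE in ees *; rewrite (negPf ees) addn0; apply: eq_count => i /=.
  by case: ev {IHes eE ees} => e' i' /=; rewrite xpair_eqE eqxx.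
rewrite (eq_count (a2 := pred0)) ?count_pred0 // => i /=.
by case: ev ne {IHes} => e' i' /= /negPf ne; rewrite xpair_eqE eq_sym ne.
Qed.

Lemma processing_orderP G p ev : processing_order G p -> ev \in p ->
  ev.1 \in edges G /\ ev.2 \in inter G ev.1.
Proof.
move=> [/perm_mem pE _]; rewrite pE => /allpairsPdep[e [i [eG iG ->]]].
by rewrite mem_enum in eG.
Qed.

Lemma processing_order_good G p : interaction_network G -> processing_order G p ->
  good_events G p.
Proof.
move=> netG ord ev /(processing_orderP ord)[eG iG]; split=> //.
exact: (inter_ge0 netG eG iG).
Qed.

(** As the sink differs from the source, its final buffer is a real number, and the maximum over
    real buffers starting from zero is the maximum flow. *)
Lemma max_flow_exists G p : snk G != src G -> (forall ev, ev \in p -> 0 <= ev.2.2) ->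
  exists m, is_max_flow G p m.
Proof.
move=> st q0; have [K [_ ex _]] := max_reach_exists (src G) (snk G) q0.
have [m [[b hb <-] bmax]] := ex (fun=> 0) (fun _ _ => lexx 0).
have initE : init_buffer G = ebuffer (src G) (fun=> 0) by apply/funext.
exists (b (snk G))%:E; split.
  exists (ebuffer (src G) b); last by rewrite /ebuffer (negPf st).
  by rewrite initE; apply/runP; exists b.
move=> m' [B]; rewrite initE => /runP[b' -> hb'] <-.
by rewrite /ebuffer (negPf st) lee_fin bmax.
Qed.

End Events.

(** * The reduced network, its processing order and its maximum flow *)

Section Reduction.
Variables (R : realType) (T : finType) (G : network R T) (vs : seq T).
Variable p : seq (event R T).
Hypothesis netG : interaction_network G.
Hypothesis chainG : source_chain G vs.
Hypothesis ordG : processing_order G p.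

Local Notation s := (src G).
Local Notation t := (snk G).
Local Notation vk := (chain_end G vs).
Local Notation k := (size vs).
Local Notation chain := (chain_edges G vs).
Local Notation node := (nth s (s :: vs)).
Local Notation G' := (reduced_network G vs p).

Lemma init_bufferE : init_buffer G = ebuffer s (fun=> 0).
Proof. exact/funext. Qed.

Lemma indeg0P (H : network R T) v :
  reflect (forall u, (u, v) \notin edges H) (indeg H v == 0%N).
Proof.
rewrite /indeg cards_eq0; apply: (iffP eqP) => [/setP E0 u|no].
  by have := E0 u; rewrite !inE => ->.
by apply/setP => u; rewrite !inE (negPf (no u)).
Qed.

Lemma outdeg0P (H : network R T) v :
  reflect (forall u, (v, u) \notin edges H) (outdeg H v == 0%N).
Proof.
rewrite /outdeg cards_eq0; apply: (iffP eqP) => [/setP E0 u|no].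
  by have := E0 u; rewrite !inE => ->.
by apply/setP => u; rewrite !inE (negPf (no u)).
Qed.

(** The first edge of the chain leaves the source, and no edge leaves the sink. *)
Lemma snk_neq_src : t != s.
Proof.
apply: contraTneq (chain_edge_edge chainG (size_chain_gt0 chainG)) => ts.
have /eqP/outdeg0P -> // : outdeg G s = 0%N.
by apply/(single_snk netG) => //; exact: src_verts.
Qed.

Lemma snk_notin_inner : t \notin inner G vs.
Proof.
apply/negP => ti; case: chainG => _ _ _ /(_ _ ti)[_].
by have /(single_snk netG (snk_verts netG)) -> : t = t by [].
Qed.

Lemma vertsE v : (v \in verts G') = (v \in verts G) && (v \notin inner G vs).
Proof. by rewrite !inE andbC. Qed.

Lemma keptE e : (e \in kept_edges G vs) = (e \in edges G) && (e \notin chain).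
Proof. by rewrite !inE andbC. Qed.

Lemma edgesE e : (e \in edges G') = (e == (s, vk)) || (e \in kept_edges G vs).
Proof. by rewrite [LHS]in_setU1. Qed.

Lemma source_edge_edges : (s, vk) \in edges G'.
Proof. by rewrite edgesE eqxx. Qed.

Lemma node_verts i : (i <= k)%N -> node i \in verts G.
Proof.
case: i => [|i] ik; first exact: src_verts.
by have [] := edges_verts netG (chain_edge_edge chainG ik).
Qed.

Lemma chain_end_verts : vk \in verts G'.
Proof.
by rewrite vertsE chain_end_notin_inner // chain_endE // node_verts.
Qed.

Lemma src_verts_reduced : s \in verts G'.
Proof. by rewrite vertsE src_notin_inner // src_verts. Qed.

(** Collapses the removed vertices onto the source, which carries paths of [G] to paths of [G']. *)
Definition contract u := if u \in inner G vs then s else u.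

(** Every chain edge but the last collapses to the source, the last becomes the new edge, and edges
    off the chain survive. *)
Lemma contract_edge u v : (u, v) \in edges G ->
  contract u = contract v \/ (contract u, contract v) \in edges G'.
Proof.
move=> uv; have [/chain_edge_nodes[j [jk -> ->]]|nuv] := boolP ((u, v) \in chain).
  have -> : contract (node j) = s.
    by rewrite /contract; case: (chain_edge_tail chainG jk) => ->; rewrite ?if_same.
  have [jk'|jk'] := ltnP j.+1 k; first by left; rewrite /contract node_inner.
  right; have -> : j.+1 = k by apply/eqP; rewrite eqn_leq jk jk'.
  rewrite -chain_endE // /contract (negPf (chain_end_notin_inner chainG)).
  exact: source_edge_edges.
right; have [/= ui vi] := kept_edge_ends chainG uv nuv.
by rewrite /contract (negPf ui) (negPf vi) edgesE keptE uv nuv orbT.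
Qed.

Lemma connect_contract u v : connect (adjacent G) u v ->
  connect (adjacent G') (contract u) (contract v).
Proof.
move=> /connectP[q + ->]; elim: q u => [|w q IHq] u /=; first by rewrite connect0.
case/andP=> uw /IHq; apply: connect_trans.
case/orP: uw => /contract_edge[->|h]; rewrite ?connect0 //;
  by apply: connect1; rewrite /adjacent h ?orbT.
Qed.

(** The greedy buffers evolve through chain events only, so the other events can be pulled out of
    the recursion. *)
Lemma reduce_events_perm B q : perm_eq (reduce_events G vs B q)
  ([seq ev <- q | ev.1 \notin chain] ++
    reduce_events G vs B [seq ev <- q | ev.1 \in chain]).
Proof.
elim: q B => //= ev q IHq B; case: (boolP (ev.1 \in chain)) => ec /=.
  rewrite ec; case: ifP => _ //.
  by rewrite perm_sym perm_catC /= perm_cons perm_catC perm_sym.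
by rewrite perm_cons.
Qed.

(** The fixed-point form says that the new events can be recovered from their interactions alone,
    which is all that [new_interactions] stores. *)
Lemma reduce_events_chain B q :
  let q' := reduce_events G vs B [seq ev <- q | ev.1 \in chain] in
  q' = [seq ((s, vk), ev.2) | ev <- q'].
Proof.
elim: q B => //= ev q IHq B; case: (boolP (ev.1 \in chain)) => ec //=.
by rewrite ec; case: ifP => _ /=; rewrite -IHq.
Qed.

Lemma reduce_events_ge0 c q ev : (forall ev, ev \in q -> 0 <= ev.2.2) ->
  ev \in reduce_events G vs (ebuffer s c) q -> 0 <= ev.2.2.
Proof.
elim: q c => [|ev' q IHq] c q0; first by rewrite in_nil.
have {}IHq c' : ev \in reduce_events G vs (ebuffer s c') q -> 0 <= ev.2.2.
  by apply: IHq => e eq; apply: q0; rewrite inE eq orbT.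
rewrite reduce_events_cons //=; case: ifP => _.
  case: ifP => [/andP[_ g0]|_]; last exact: IHq.
  by rewrite inE => /predU1P[-> /=|/IHq//]; exact: ltW.
by rewrite inE => /predU1P[->|/IHq//]; apply: q0; rewrite mem_head.
Qed.

(** A new event keeps the timestamp of the event it replaces, so sortedness in time is inherited. *)
Lemma reduce_events_times B q :
  subseq [seq ev.2.1 | ev <- reduce_events G vs B q] [seq ev.2.1 | ev <- q].
Proof.
elim: q B => [//|ev q IHq] B; rewrite [reduce_events _ _ _ _]/= map_cons.
case: ifP => _; last by rewrite /= eqxx.
case: ifP => _; first by rewrite /= eqxx.
by apply: (subseq_trans (IHq _)); exact: subseq_cons.
Qed.

Lemma interaction_network_reduced : interaction_network G'.
Proof.
have gp := processing_order_good netG ordG.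
split.
- move=> e; rewrite edgesE keptE => /predU1P[->|/andP[eG ec]].
    by rewrite src_verts_reduced chain_end_verts.
  have [e1 e2] := kept_edge_ends chainG eG ec.
  by have [v1 v2] := edges_verts netG eG; rewrite !vertsE v1 v2 e1 e2.
- move=> e i _; rewrite mem_cat => /orP[].
    by case: ifP => //; rewrite keptE => /andP[eG _]; exact: inter_ge0.
  case: ifP => // _ /mapP[ev + ->]; rewrite /reduced_order init_bufferE.
  apply: reduce_events_ge0 => ev'; rewrite mem_filter => /andP[_ /gp[]//].
- exact: src_verts_reduced.
- by rewrite vertsE snk_notin_inner (snk_verts netG).
- move=> v; rewrite vertsE => /andP[vG vi]; split=> [/eqP/indeg0P no|->].
    apply/(single_src netG vG)/eqP/indeg0P => u; apply/negP => uv.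
    have := no u; rewrite edgesE keptE uv /= negb_or negbK => /andP[uvs].
    (* An incoming edge of [v] lost in the reduction lies on the chain; as [v] is not inner, it is
       [v_k], which the new edge enters. *)
    move=> /chain_edge_nodes[j [jk uE vE]].
    have [jk'|jk'] := ltnP j.+1 k; first by move: vi; rewrite vE node_inner.
    have := no s; rewrite vE (_ : j.+1 = k); last by apply/eqP; rewrite eqn_leq jk jk'.
    by rewrite -chain_endE // source_edge_edges.
  apply/eqP/indeg0P => u; rewrite edgesE xpair_eqE [s == _]eq_sym.
  rewrite (negPf (chain_end_neq_src chainG)) andbF keptE.
  by have /(single_src netG (src_verts netG))/eqP/indeg0P/(_ u)/negPf-> : s = s by [].
- move=> v; rewrite vertsE => /andP[vG vi]; split=> [/eqP/outdeg0P no|->].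
    apply/(single_snk netG vG)/eqP/outdeg0P => u; apply/negP => vu.
    have := no u; rewrite edgesE keptE vu /= negb_or negbK => /andP[_].
    (* A lost outgoing edge of a vertex that is not inner starts at the source, which the new edge
       leaves. *)
    move=> /chain_edge_nodes[j [jk vE uE]]; move: vi; rewrite vE.
    case: (chain_edge_tail chainG jk) => [js|->//]; have := no vk.
    by rewrite vE js source_edge_edges.
  apply/eqP/outdeg0P => u; rewrite edgesE xpair_eqE (negPf snk_neq_src) keptE.
  by have /(single_snk netG (snk_verts netG))/eqP/outdeg0P/(_ u)/negPf-> : t = t by [].
- move=> u v; rewrite !vertsE => /andP[uG ui] /andP[vG vi].
  have := connect_contract (Defs.connected netG uG vG).
  by rewrite /contract (negPf ui) (negPf vi).
Qed.

(** Multiplicities of kept and new events are counted separately and add up, also when the new edge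
    merges with a kept edge from [s] to [v_k]. *)
Lemma processing_order_reduced : processing_order G' (reduced_order G vs p).
Proof.
case: ordG => pE p_sorted; split; last first.
  have timeE (q : seq (event R T)) : sorted (fun ev1 ev2 => ev1.2.1 <= ev2.2.1) q =
      sorted <=%R [seq ev.2.1 | ev <- q] by rewrite sorted_map.
  rewrite timeE; apply: subseq_sorted (reduce_events_times _ _) _;
    first exact: le_trans.
  by rewrite -timeE.
have nE : reduce_events G vs (init_buffer G) [seq ev <- p | ev.1 \in chain] =
    [seq ((s, vk), i) | i <- new_interactions G vs p].
  by rewrite -map_comp; exact: reduce_events_chain.
rewrite /perm_eq; apply/allP => ev _ /=; apply/eqP.
rewrite (permP (reduce_events_perm _ _)) nE count_cat count_mem_events edgesE.
have -> : count_mem ev [seq ev <- p | ev.1 \notin chain] =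
    if ev.1 \in kept_edges G vs then count_mem ev.2 (inter G ev.1) else 0%N.
  rewrite count_filter keptE; case: (boolP (ev.1 \in chain)) => ec /=.
    rewrite andbF (eq_count (a2 := pred0)) ?count_pred0 // => ev' /=.
    by case: eqP => // ->; rewrite ec.
  rewrite andbT -count_mem_events -(permP pE); apply: eq_count => ev' /=.
  by case: eqP => // ->; rewrite ec.
have -> : count_mem ev [seq ((s, vk), i) | i <- new_interactions G vs p] =
    if ev.1 == (s, vk) then count_mem ev.2 (new_interactions G vs p) else 0%N.
  rewrite count_map; case: eqP => eE.
    by apply: eq_count => i /=; rewrite (surjective_pairing ev) eE xpair_eqE eqxx.
  rewrite (eq_count (a2 := pred0)) ?count_pred0 // => i /=.
  by apply/eqP => iE; apply: eE; rewrite -iE.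
rewrite /= count_cat; case: (ev.1 == _); case: (ev.1 \in _) => //=.
Qed.

(** Both simulations start from zero buffers and zero receipts. The sink is neither the source nor
    inner, so lifting preserves its final buffer and the converse simulation does not decrease
    it. *)
Lemma max_flow_reduced m :
  is_max_flow G' (reduced_order G vs p) m -> is_max_flow G p m.
Proof.
have gp := processing_order_good netG ordG.
have c0 : nonneg_buffer s (fun=> 0 : R) by [].
have initE' : init_buffer G' = ebuffer s (fun=> 0) by exact/funext.
have tout b : ebuffer s b t = (b t)%:E by rewrite /ebuffer (negPf snk_neq_src).
rewrite /is_max_flow /achievable_flow /reduced_order initE' init_bufferE.
case=> -[_ /runP[b' -> hb'] <-] bmax; split.
  have [b hb bE] := reach_reduced_reach chainG gp c0 (fun _ _ _ => erefl)
    (fun _ _ => lexx 0) hb'.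
  exists (ebuffer s b); first by apply/runP; exists b.
  by rewrite !tout bE ?snk_neq_src ?snk_notin_inner.
move=> _ [_ /runP[b -> hb] <-].
have [||||b1 hb1 bb1] := reach_reach_reduced (b' := fun=> 0) (c := fun=> 0)
  (A := fun=> 0) (Ag := fun=> 0) chainG gp c0 _ _ _ _ hb.
- by move=> v _ _; rewrite subrr if_same addr0.
- by move=> i _ _; rewrite subrr.
- by move=> i _ _; rewrite subrr.
- by [].
apply: (@le_trans _ _ (b1 t)%:E).
  by rewrite tout lee_fin bb1 ?snk_neq_src ?snk_notin_inner.
apply: bmax; exists (ebuffer s b1); last exact: tout.
by apply/runP; exists b1.
Qed.

End Reduction.

Theorem lemma3 (R : realType) (T : finType) (G : network R T)
    (vs : seq T) (p : seq (event R T)) :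
  interaction_network G ->
  source_chain G vs ->
  processing_order G p ->
  let G' := reduced_network G vs p in
  let p' := reduced_order G vs p in
  [/\ interaction_network G',
      processing_order G' p' &
      exists m : \bar R, is_max_flow G p m /\ is_max_flow G' p' m].
Proof.
move=> netG chainG ordG G' p'.
have netG' : interaction_network G' by exact: interaction_network_reduced.
have ordG' : processing_order G' p' by exact: processing_order_reduced.
(* Existence is established in [G'] only; the same value is then maximal for [G]. *)
split=> //; have [m mmax] : exists m, is_max_flow G' p' m.
  apply: max_flow_exists; first exact: snk_neq_src netG chainG.
  by move=> ev /(processing_order_good netG' ordG')[].
by exists m; split=> //; exact: max_flow_reduced mmax.
Qed.
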